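(* If $(\Delta,\Delta')$ and $(\Gamma,\Gamma')$ are two simplicial pairs on disjoint vertex sets, then $$S_{(\Delta,\Delta')*(\Gamma,\Gamma')}(t,q)=S_{(\Delta,\Delta')}(t,q)\,S_{(\Gamma,\Gamma')}(t,q).$$
   Context: A simplicial complex $\Delta$ on a finite vertex set $V$ is a collection of subsets of $V$ (faces) closed under taking subsets. The empty set is a face (of dimension $-1$) of every complex that has at least one face; the empty complex $\emptyset$ (no faces at all) is allowed; an element $v\in V$ need not satisfy $\{v\}\in\Delta$. Put $\dim F=|F|-1$. A simplicial pair $(\Delta,\Delta')$ consists of two simplicial complexes on the same vertex set; pairs with the same set difference $\Delta\setminus\Delta'$ are identified, so a pair is determined by its set of faces $\Delta\setminus\Delta'$. For $i\ge -1$, $C_i(\Delta,\Delta';\mathbb R)$ is the real vector space of formal linear combinations of oriented $i$-dimensional faces $[F]$, $F\in\Delta\setminus\Delta'$, and $\partial_i\colon C_i\to C_{i-1}$ is the usual signed simplicial boundary operator with all terms outside $\Delta\setminus\Delta'$ dropped; $\partial_i^*$ is its adjoint (transposed matrix in the natural bases). The Laplacian is $L_i(\Delta,\Delta')=\partial_{i+1}\partial_{i+1}^*+\partial_i^*\partial_i$, and $\mathbf s_i(\Delta,\Delta')$ is the multiset of its eigenvalues (non-negative reals). The spectrum polynomial is the generating function $$S_{(\Delta,\Delta')}(t,q)=\sum_{i\ge 0}t^i\sum_{\lambda\in\mathbf s_{i-1}(\Delta,\Delta')}q^\lambda$$ (exponents of $q$ may be arbitrary non-negative reals). The join of two simplicial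 pairs on disjoint vertex sets is $(\Delta,\Delta')*(\Gamma,\Gamma')=\{F\cup G: F\in\Delta\setminus\Delta',\ G\in\Gamma\setminus\Gamma'\}$, which is the set of faces of the simplicial pair $(\Delta*\Gamma,\ (\Delta'*\Gamma)\cup(\Delta*\Gamma'))$, where $\Delta*\Gamma=\{F\cup G:F\in\Delta,G\in\Gamma\}$. *)

(* Defs.v *)
From HB Require Import structures.
From mathcomp Require Import all_boot all_order all_algebra.
From mathcomp Require Import polyrcf monalg.

Set Implicit Arguments.
Unset Strict Implicit.
Unset Printing Implicit Defensive.

Import Order.TTheory GRing.Theory Num.Theory.

Local Open Scope ring_scope.

(* Complexes live in an ambient finite type T of potential vertices.  Both set0
   (no face at all) and [set set0] are complexes, and a vertex v in V need not
   be such that [set v] is a face. *)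
Record simplicial_complex (T : finType) (V : {set T}) := SimplicialComplex {
  complex_faces :> {set {set T}};
  complex_sub : forall F, F \in complex_faces -> F \subset V;
  complex_closed : forall F G : {set T},
    F \in complex_faces -> G \subset F -> G \in complex_faces
}.

Record simplicial_pair (T : finType) (V : {set T}) := SimplicialPair {
  pair_big : simplicial_complex V;
  pair_small : simplicial_complex V
}.

Definition pair_faces (T : finType) (V : {set T}) (P : simplicial_pair V) :
    {set {set T}} :=
  pair_big P :\: pair_small P.

Definition join_faces (T : finType) (A B : {set {set T}}) : {set {set T}} :=
  [set F :|: G | F in A, G in B].

Section Join.
Variables (T : finType) (V W : {set T}).

Section JoinComplex.
Variables (D : simplicial_complex V) (E : simplicial_complex W).

Lemma join_complex_sub H : H \in join_faces D E -> H \subset V :|: W.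
Proof.
by case/imset2P=> F G /complex_sub sFV /complex_sub sGW ->; apply: setUSS.
Qed.

Lemma join_complex_closed (H K : {set T}) :
  H \in join_faces D E -> K \subset H -> K \in join_faces D E.
Proof.
case/imset2P=> F G FD GE -> sK; apply/imset2P.
exists (K :&: F) (K :&: G); last by rewrite -setIUr (setIidPl sK).
  exact: complex_closed FD (subsetIr _ _).
exact: complex_closed GE (subsetIr _ _).
Qed.

Definition join_complex : simplicial_complex (V :|: W) :=
  SimplicialComplex join_complex_sub join_complex_closed.
End JoinComplex.

Section UnionComplex.
Variables (D E : simplicial_complex V).

Lemma union_complex_sub F : F \in (D : {set {set T}}) :|: E -> F \subset V.
Proof. by case/setUP => /complex_sub. Qed.

Lemma union_complex_closed (F G : {set T}) :
  F \in (D : {set {set T}}) :|: E -> G \subset F ->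
  G \in (D : {set {set T}}) :|: E.
Proof.
by case/setUP=> FD sGF; apply/setUP; [left | right]; apply: complex_closed FD _.
Qed.

Definition union_complex : simplicial_complex V :=
  SimplicialComplex union_complex_sub union_complex_closed.
End UnionComplex.
End Join.

Definition join_pair (T : finType) (V W : {set T})
    (P : simplicial_pair V) (Q : simplicial_pair W) :
    simplicial_pair (V :|: W) :=
  SimplicialPair
    (join_complex (pair_big P) (pair_big Q))
    (union_complex (join_complex (pair_small P) (pair_big Q))
                   (join_complex (pair_big P) (pair_small Q))).

Lemma join_pair_faces (T : finType) (V W : {set T})
    (P : simplicial_pair V) (Q : simplicial_pair W) :
  [disjoint V & W] ->
  pair_faces (join_pair P Q) = join_faces (pair_faces P) (pair_faces Q).
Proof.
move=> dVW; have uniqUI (F G : {set T}) : F \subset V -> G \subset W ->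
    ((F :|: G) :&: V = F) * ((F :|: G) :&: W = G).
  move=> sF sG; rewrite !setIUl (setIidPl sF) (setIidPl sG).
  have -> : G :&: V = set0.
    by apply/eqP; rewrite setI_eq0 disjoint_sym; apply: disjointWr sG dVW.
  have -> : F :&: W = set0.
    by apply/eqP; rewrite setI_eq0; apply: disjointWl sF dVW.
  by rewrite set0U setU0.
have uniqU (F F' G G' : {set T}) : F \subset V -> F' \subset V ->
    G \subset W -> G' \subset W -> F :|: G = F' :|: G' -> F = F' /\ G = G'.
  move=> sF sF' sG sG' E.
  have [eF eG] := uniqUI F G sF sG; have [eF' eG'] := uniqUI F' G' sF' sG'.
  by split; [rewrite -eF E | rewrite -eG E].
apply/setP=> H; apply/setDP/imset2P.
  case=> /imset2P[F G FD GE ->] /setUP nH; exists F G => //; apply/setDP.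
    split=> //; apply/negP=> FD'; apply: nH; left.
    by apply/imset2P; exists F G.
  split=> //; apply/negP=> GE'; apply: nH; right.
  by apply/imset2P; exists F G.
case=> F G /setDP[FD FD'] /setDP[GE GE'] ->.
split; first by apply/imset2P; exists F G.
apply/negP=> /setUP[] /imset2P[F1 G1 F1D G1E].
  case/(uniqU _ _ _ _ (complex_sub FD) (complex_sub F1D)
          (complex_sub GE) (complex_sub G1E)) => eF _.
  by rewrite eF F1D in FD'.
case/(uniqU _ _ _ _ (complex_sub FD) (complex_sub F1D)
        (complex_sub GE) (complex_sub G1E)) => _ eG.
by rewrite eG G1E in GE'.
Qed.

Section Laplacian.
Variables (R : rcfType) (T : finType).
Implicit Types (X A B : {set {set T}}) (F : {set T}) (i : int).

Definition faces_dim X i : {set {set T}} :=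
  [set F in X | (#|F|%:Z - 1 == i)].

(* Every face is oriented by the enumeration order of T:
   d[v_0, ..., v_k] = sum_j (-1)^j [v_0, ..., ^v_j, ..., v_k], where j is the
   number of vertices of the face preceding v_j. *)
Definition vertex_sign F (v : T) : R :=
  (-1) ^+ #|[set u in F | (enum_rank u < enum_rank v)%N]|.

(* Matrix, acting on column vectors, of the simplicial boundary from the span
   of B to the span of A: the terms that are not in A are dropped. *)
Definition boundary_mx A B : 'M[R]_(#|A|, #|B|) :=
  \matrix_(a < #|A|, b < #|B|)
     let F : {set T} := enum_val a in
     let G : {set T} := enum_val b in
     \sum_(v in G | G :\ v == F) vertex_sign G v.

(* The bases are kept as two indices j and i, with j = i - 1 in every use, to
   avoid casting along i + 1 - 1 = i. *)
Definition boundary X j i : 'M[R]_(#|faces_dim X j|, #|faces_dim X i|) :=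
  boundary_mx (faces_dim X j) (faces_dim X i).

Definition laplacian X i : 'M[R]_#|faces_dim X i| :=
  boundary X i (i + 1) *m (boundary X i (i + 1))^T +
  (boundary X (i - 1) i)^T *m boundary X (i - 1) i.

End Laplacian.

(* The multiset of the real eigenvalues of A, each repeated according to its
   multiplicity as a root of the characteristic polynomial. *)
Definition spectrum (R : rcfType) (n : nat) (A : 'M[R]_n) : seq R :=
  flatten [seq nseq (mup x (char_poly A)) x | x <- rootsR (char_poly A)].

Lemma mem_spectrum (R : rcfType) (n : nat) (A : 'M[R]_n) (x : R) :
  (x \in spectrum A) = eigenvalue A x.
Proof.
have p0 : char_poly A != 0 by rewrite monic_neq0 ?char_poly_monic.
have rE y : (y \in rootsR (char_poly A)) = root (char_poly A) y.
  by rewrite -(roots_on_rootsR p0) in_itv.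
rewrite eigenvalue_root_char; apply/flatten_mapP/idP.
  by case=> y; rewrite rE => ry /nseqP[-> _].
by move=> rx; exists x; rewrite ?rE // mem_nseq -XsubC_dvd // dvdp_XsubCl rx eqxx.
Qed.

Lemma count_spectrum (R : rcfType) (n : nat) (A : 'M[R]_n) (x : R) :
  count_mem x (spectrum A) = mup x (char_poly A).
Proof.
have p0 : char_poly A != 0 by rewrite monic_neq0 ?char_poly_monic.
have rE : (x \in rootsR (char_poly A)) = root (char_poly A) x.
  by rewrite -(roots_on_rootsR p0) in_itv.
have ur : uniq (rootsR (char_poly A)) by apply: uniq_roots.
rewrite /spectrum count_flatten -map_comp sumnE big_map.
under eq_bigr => y _ do rewrite /= count_nseq /=.
have [rx|nrx] := boolP (x \in rootsR (char_poly A)).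
  rewrite (bigD1_seq x) //= eqxx mul1n big1 ?addn0 // => y /negPf->.
  by rewrite mul0n.
rewrite big_seq big1 ?mupNroot -?rE // => y ry.
by case: eqP => [e|]; rewrite ?mul0n // -e ry in nrx *.
Qed.

Lemma spectrum_laplacian_ge0 (R : rcfType) (T : finType)
    (X : {set {set T}}) (i : int) (x : R) :
  x \in spectrum (laplacian R X i) -> 0 <= x.
Proof.
rewrite mem_spectrum => /eigenvalueP[v vL v0].
have sq m (u : 'rV[R]_m) : 0 <= (u *m u^T) 0 0.
  by rewrite !mxE sumr_ge0 // => j _; rewrite !mxE -expr2 sqr_ge0.
have vv : 0 < (v *m v^T) 0 0.
  rewrite lt0r sq andbT; apply: contraNneq v0 => e.
  apply/eqP/rowP=> j; rewrite mxE; apply/eqP; rewrite -sqrf_eq0.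
  move/eqP: e; rewrite mxE psumr_eq0; last first.
    by move=> k _; rewrite !mxE -expr2 sqr_ge0.
  by move=> /allP /(_ j); rewrite mem_index_enum !mxE -expr2 => /(_ isT).
rewrite -(pmulr_lge0 _ vv).
have -> : x * (v *m v^T) 0 0 = (v *m laplacian R X i *m v^T) 0 0.
  by rewrite vL -scalemxAl [RHS]mxE.
rewrite /laplacian; set a := boundary _ _ _ _; set b := boundary _ _ _ _.
have -> : v *m (a *m a^T + b^T *m b) *m v^T =
    (v *m a) *m (v *m a)^T + (v *m b^T) *m (v *m b^T)^T.
  by rewrite !trmx_mul trmxK mulmxDr mulmxDl !mulmxA.
by rewrite mxE addr_ge0.
Qed.

(* Exponents of q: the additive monoid of non-negative elements of R, written
   multiplicatively as a commutative monoid of monomials q^x. *)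
Section Exponents.
Variable R : realDomainType.

Record qmonom : predArgType := QMonom {
  qexp : R;
  qexp_ge0 : 0 <= qexp
}.

HB.instance Definition _ := [isSub for qexp].
HB.instance Definition _ := [Choice of qmonom by <:].

Definition qmonom1 : qmonom := QMonom (lexx 0).

Definition qmonomM (x y : qmonom) : qmonom :=
  QMonom (addr_ge0 (qexp_ge0 x) (qexp_ge0 y)).

Lemma qmonomMA : associative qmonomM.
Proof. by move=> x y z; apply: val_inj; rewrite /= addrA. Qed.

Lemma qmonomMC : commutative qmonomM.
Proof. by move=> x y; apply: val_inj; rewrite /= addrC. Qed.

Lemma qmonom1M : left_id qmonom1 qmonomM.
Proof. by move=> x; apply: val_inj; rewrite /= add0r. Qed.

Lemma qmonomM1 : right_id qmonom1 qmonomM.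
Proof. by move=> x; apply: val_inj; rewrite /= addr0. Qed.

Lemma qmonom_unit x y :
  qmonomM x y = qmonom1 -> x = qmonom1 /\ y = qmonom1.
Proof.
move=> /(congr1 qexp) /eqP /=.
rewrite paddr_eq0 ?qexp_ge0 // => /andP[/eqP ex /eqP ey].
by split; apply: val_inj.
Qed.

HB.instance Definition _ := Choice_isMonomialDef.Build qmonom
  qmonomMA qmonom1M qmonomM1 qmonom_unit.
HB.instance Definition _ := MonomialDef_isConomialDef.Build qmonom qmonomMC.
End Exponents.

(* q^x; the default value for x < 0 is never used on a Laplacian spectrum, by
   spectrum_laplacian_ge0. *)
Definition qpow (R : realDomainType) (x : R) : {malg int[qmonom R]} :=
  << insubd (qmonom1 R) x >>.

Lemma qpowD (R : realDomainType) (x y : R) :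
  0 <= x -> 0 <= y -> qpow (x + y) = qpow x * qpow y.
Proof.
move=> x0 y0; rewrite /qpow malgM_def fgmulUU mulr1; congr mkmalgU.
have qE (z : R) : 0 <= z -> qexp (insubd (qmonom1 R) z) = z.
  by move=> z0; rewrite -[qexp _]/(val _) insubdK.
by apply: val_inj; rewrite insubdK ?[_ \in _]addr_ge0 //= !qE.
Qed.

(* The variable t is the 'X of the outer polynomial ring.  The sum over i is
   cut off at #|V|; see coef_spectrum_poly. *)
Definition spectrum_poly (R : rcfType) (T : finType) (V : {set T})
    (P : simplicial_pair V) : {poly {malg int[qmonom R]}} :=
  \poly_(i < #|V|.+1)
     \sum_(x <- spectrum (laplacian R (pair_faces P) (i%:Z - 1))) qpow x.

Lemma coef_spectrum_poly (R : rcfType) (T : finType) (V : {set T})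
    (P : simplicial_pair V) (i : nat) :
  (spectrum_poly R P)`_i =
  \sum_(x <- spectrum (laplacian R (pair_faces P) (i%:Z - 1))) qpow x.
Proof.
rewrite coef_poly; case: ltnP => // ltVi.
rewrite big_seq big1 // => x; rewrite mem_spectrum => /eigenvalueP[v _].
suff e : #|faces_dim (pair_faces P) (i%:Z - 1)| = 0%N.
  by case/eqP; apply/rowP=> -[j ltj]; exfalso; rewrite e in ltj.
apply: eq_card0 => F; rewrite !inE; apply/negP => /andP[/andP[_ FD]].
move=> /eqP/addIr[] e; move: (subset_leq_card (complex_sub FD)).
by rewrite e leqNgt ltVi.
Qed.

(* Main.v *)
(* Up to shuffle signs the chain space of a join is the tensor product of the
   two chain spaces, with boundary d (x) 1 + s (x) d where s acts by (-1)^|F|.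
   Since s anticommutes with d and with its transpose, the cross terms of the
   Laplacian cancel and it becomes L (x) 1 + 1 (x) L.  Tensoring eigenbases of
   the two factors, which exist because Laplacians are real symmetric, yields an
   eigenbasis of the join whose eigenvalues are the sums of eigenvalues. *)

Require Import Defs.
From mathcomp Require Import all_boot all_order all_algebra.
From mathcomp Require Import reals monalg.
From mathcomp Require Import complex ring.

Set Implicit Arguments.
Unset Strict Implicit.
Unset Printing Implicit Defensive.

Import Order.TTheory GRing.Theory Num.Theory.

Local Open Scope ring_scope.

(** * Diagonalization of symmetric matrices over a real closed field *)

Lemma symmetric_diagonalization (R : rcfType) n (A : 'M[R]_n) : A^T = A ->
  exists U W : 'M_n, exists d : 'rV_n,
    W *m U = 1%:M /\ A *m U = U *m diag_mx d.
Proof.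
(* The matrix is diagonalized as a Hermitian matrix over the algebraic closure [R[i]], where its
   eigenvalues are real; the result is then descended to [R]. *)
move=> symA; pose C : numClosedFieldType := R[i].
pose toC : {rmorphism R -> C} := real_complex R.
have toC_real x : toC x \is Num.real by rewrite complex_real.
have map_real m p (M : 'M_(m, p)) : map_mx toC M \is a mxOver Num.real.
  by apply/mxOverP=> i j; rewrite mxE.
have lift_real m p (M : 'M[C]_(m, p)) : M \is a mxOver Num.real ->
    exists M0, M = map_mx toC M0.
  move=> /mxOverP Mre; exists (map_mx (@complex.Re R) M).
  by apply/matrixP=> i j; rewrite !mxE; apply/esym; apply: RRe_real.
have hermA : map_mx toC A \is hermsymmx.
  apply: realsym_hermsym => //.
  by apply/is_hermitianmxP; rewrite expr0 scale1r map_mx_id // map_trmx symA.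
have [d eqd] := lift_real _ _ _ (hermitian_spectral_diag_real hermA).
have := hermitian_normalmx hermA => /orthomx_spectralP.
rewrite eqd -map_diag_mx => eqA.
have := spectral_unit (map_mx toC A).
move: (spectralmx _) eqA => P eqA Pu.
have sim : exists2 P, P \in unitmx &
    simmx_for P (map_mx toC A) (map_mx toC (diag_mx d)).
  by exists P => //; apply/simmxP => //; rewrite eqA !mulmxA mulmxV ?mul1mx.
(* Real matrices similar over [R[i]] are similar over [R]. The real change of basis is only known to
   be invertible, not orthogonal, so its inverse is returned along with it. *)
case: (real_similar sim (map_real _ _ _) (map_real _ _ _)) => P'.
case/andP=> /lift_real[P0 ->]; rewrite map_unitmx => P0u.
move/(simmxP _); rewrite map_unitmx -!map_mxM => /(_ P0u) /map_mx_inj eqPA.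
exists (invmx P0), P0, d; split; first exact: mulmxV.
by rewrite -[LHS](mulKmx P0u) (mulmxA P0) eqPA mulmxK.
Qed.

(** * Laplacians on functions of sets, and their eigenbases *)

Section Eigenbasis.
Variables (R : rcfType) (T : finType).
Implicit Types (X Y : {set {set T}}) (F G H : {set T}) (u : {set T} -> R).

Definition incidence F G : R := \sum_(v in G | G :\ v == F) vertex_sign R G v.

Lemma incidence_card F G : incidence F G != 0 -> #|G| = #|F|.+1.
Proof.
apply: contra_neq_eq => cFG; apply: big_pred0 => v; apply/negbTE.
apply: contraNN cFG => /andP[vG /eqP <-].
by rewrite (cardsD1 v G) vG.
Qed.

(** Chains are functions on sets, all degrees at once, so that the operators carry no dimension
    index and need no casts. *)
Definition bd X u F := \sum_(G in X) incidence F G * u G.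
Definition cobd X u F := \sum_(G in X) incidence G F * u G.
Definition lap X u F := bd X (cobd X u) F + cobd X (bd X u) F.

Lemma sum_faces_dim X (i : int) (f : {set T} -> R) :
  (forall F, F \in X -> #|F|%:Z - 1 != i -> f F = 0) ->
  \sum_(b < #|faces_dim X i|) f (enum_val b) = \sum_(F in X) f F.
Proof.
move=> f0; rewrite -big_enum_val /=.
rewrite big_mkcond [RHS]big_mkcond; apply: eq_bigr => F _.
rewrite inE; case: (boolP (F \in X)) => //= FX.
by case: eqVneq => //= ni; rewrite f0.
Qed.

(** A nonzero incidence forces cardinalities to differ by one. Hence on chains supported in degree
    [i] the sums over all of [X] only see degrees [i - 1], [i] and [i + 1], as the matrices do. *)
Lemma laplacian_lap X (i : int) u (a : 'I_#|faces_dim X i|) :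
  (forall F, F \in X -> #|F|%:Z - 1 != i -> u F = 0) ->
  \sum_b laplacian R X i a b * u (enum_val b) = lap X u (enum_val a).
Proof.
move=> u0.
have := enum_valP a; rewrite inE => /andP[_]; rewrite subr_eq => /eqP cA.
have eq_card_succ F G : incidence F G != 0 -> #|G|%:Z = #|F|%:Z + 1.
  by move/incidence_card->; rewrite -addn1 PoszD.
under eq_bigr => b _ do rewrite mxE mulrDl.
rewrite big_split /=; congr (_ + _).
  under eq_bigr => b _ do rewrite mxE mulr_suml.
  rewrite exchange_big /bd -(@sum_faces_dim _ (i + 1)) /=; last first.
    move=> F _ ni; case: (eqVneq (incidence (enum_val a) F) 0) =>
      [->|/eq_card_succ e].
      by rewrite mul0r.
    by rewrite e addrK cA eqxx in ni.
  apply: eq_bigr => c _; rewrite /cobd -(@sum_faces_dim _ i); last first.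
    by move=> F FX /(u0 _ FX)->; rewrite mulr0.
  by rewrite mulr_sumr; apply: eq_bigr => b _; rewrite !mxE mulrA.
under eq_bigr => b _ do rewrite mxE mulr_suml.
rewrite exchange_big /cobd -(@sum_faces_dim _ (i - 1)) /=; last first.
  move=> F _ ni; case: (eqVneq (incidence F (enum_val a)) 0) =>
      [->|/eq_card_succ e].
    by rewrite mul0r.
  by rewrite (addIr _ (etrans (esym e) cA)) eqxx in ni.
apply: eq_bigr => c _; rewrite /bd -(@sum_faces_dim _ i); last first.
  by move=> F FX /(u0 _ FX)->; rewrite mulr0.
by rewrite mulr_sumr; apply: eq_bigr => b _; rewrite !mxE mulrA.
Qed.

(** The total Laplacian preserves degree: two faces sharing a facet or a coface have equal
    cardinality. *)
Lemma lap_eq0 X u H :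
  (forall G, G \in X -> #|G| = #|H| -> u G = 0) -> lap X u H = 0.
Proof.
move=> u0; rewrite /lap /bd /cobd !big1 ?addr0 // => K _;
  rewrite big_distrr /= big1 // => G GX; rewrite mulrA.
- have [->|/incidence_card cHK] := eqVneq (incidence K H) 0; rewrite ?mul0r //.
  have [->|/incidence_card cGK] := eqVneq (incidence K G) 0.
    by rewrite mulr0 mul0r.
  by rewrite u0 ?mulr0 // cHK.
- have [->|/incidence_card cHK] := eqVneq (incidence H K) 0; rewrite ?mul0r //.
  have [->|/incidence_card cGK] := eqVneq (incidence G K) 0.
    by rewrite mulr0 mul0r.
  by rewrite u0 ?mulr0 //; move: cGK; rewrite cHK => -[].
Qed.

(* Condition [eigen_dual] is biorthogonality, so that the u F are a basis of the
   functions on X indexed by X itself. *)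
Record eigenbasis X (d : {set T} -> R) (u w : {set T} -> {set T} -> R) : Prop :=
  Eigenbasis {
    eigen_lap : {in X &, forall F H, lap X (u F) H = d F * u F H};
    eigen_dual : {in X &, forall F G,
      \sum_(H in X) w F H * u G H = (F == G)%:R};
    eigen_card : {in X &, forall F H, #|F| != #|H| -> u F H = 0}
  }.

Lemma similar_char_poly n (A U W : 'M[R]_n) (d : 'rV_n) :
  W *m U = 1%:M -> A *m U = U *m diag_mx d ->
  char_poly A = \prod_(i < n) ('X - (d 0 i)%:P).
Proof.
move=> WU AU; have UW := mulmx1C WU.
have -> : \prod_(i < n) ('X - (d 0 i)%:P) = char_poly (diag_mx d).
  rewrite char_poly_trig ?diag_mx_is_trig //.
  by apply: eq_bigr => i _; rewrite mxE eqxx.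
have -> : A = U *m diag_mx d *m W by rewrite -AU -mulmxA UW mulmx1.
rewrite /char_poly /char_poly_mx !map_mxM /=.
set U' := map_mx _ U; set W' := map_mx _ W; set D' := map_mx _ (diag_mx d).
have UW' : U' *m W' = 1%:M by rewrite -map_mxM UW map_mx1.
have -> : 'X%:M - U' *m D' *m W' = U' *m ('X%:M - D') *m W'.
  by rewrite mulmxBr mulmxBl scalar_mxC -(mulmxA _ U') UW' mulmx1.
by rewrite !det_mulmx mulrAC -det_mulmx UW' det1 mul1r.
Qed.

(** By homogeneity, the vectors indexed by faces of dimension [i] restrict to the columns of a
    square matrix; biorthogonality makes it invertible, and it diagonalizes the Laplacian. *)
Lemma spectrum_eigenbasis X d (u w : {set T} -> {set T} -> R) (i : int) :
  eigenbasis X d u w ->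
  perm_eq (spectrum (laplacian R X i)) [seq d F | F <- enum (faces_dim X i)].
Proof.
case=> lapX dualX cardX; set A := faces_dim X i; set L := laplacian R X i.
have AX (a : 'I_#|A|) : enum_val a \in X.
  by have := enum_valP a; rewrite inE => /andP[].
have cA (a : 'I_#|A|) F : F \in X -> #|F|%:Z - 1 != i -> u (enum_val a) F = 0.
  have := enum_valP a; rewrite inE => /andP[_ /eqP <-].
  rewrite (inj_eq (addIr _)) => FX ne; apply: cardX => //.
  by apply: contraNneq ne => ->.
pose U : 'M[R]_#|A| := \matrix_(b, f) u (enum_val f) (enum_val b).
pose W : 'M[R]_#|A| := \matrix_(f, b) w (enum_val f) (enum_val b).
pose D : 'rV[R]_#|A| := \row_f d (enum_val f).
have WU : W *m U = 1%:M.
  apply/matrixP=> f g'; rewrite !mxE -(inj_eq enum_val_inj) -dualX //.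
  rewrite -(@sum_faces_dim _ i) => [|F FX /(cA _ _ FX)->]; last by rewrite mulr0.
  by apply: eq_bigr => b _; rewrite !mxE.
have LU : L *m U = U *m diag_mx D.
  apply/matrixP=> b f; rewrite mul_mx_diag !mxE mulrC -lapX //.
  rewrite -laplacian_lap; last exact: cA.
  by apply: eq_bigr => c _; rewrite [U c f]mxE.
(* Multisets are compared by counting [x]: both counts are its multiplicity in the characteristic
   polynomial. *)
apply/allP=> x _ /=; apply/eqP.
rewrite count_spectrum (similar_char_poly WU LU) -mu_prod_XsubC big_map big_enum.
by rewrite [in RHS]big_enum_val; congr mup; apply: eq_bigr => f _; rewrite mxE.
Qed.

(** Each [d F] lies in the spectrum of a Laplacian. This supplies the sign conditions of [qpowD]. *)
Lemma eigenbasis_ge0 X d (u w : {set T} -> {set T} -> R) :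
  eigenbasis X d u w -> {in X, forall F, 0 <= d F}.
Proof.
move=> eX F FX; apply: (@spectrum_laplacian_ge0 _ _ X (#|F|%:Z - 1)).
rewrite (perm_mem (spectrum_eigenbasis _ eX)) map_f // mem_enum inE FX.
exact: eqxx.
Qed.

Lemma laplacian_sym X i : (laplacian R X i)^T = laplacian R X i.
Proof. by rewrite /laplacian linearD /= !trmx_mul !trmxK. Qed.

Lemma exists_eigenbasis X :
  exists d (u w : {set T} -> {set T} -> R), eigenbasis X d u w.
Proof.
(* Each degree is diagonalized separately. The index [n] is the cardinality of the faces, one more
   than their dimension. *)
pose A (n : 'I_#|T|.+1) := faces_dim X (n%:Z - 1).
have diag n := symmetric_diagonalization (laplacian_sym X (n%:Z - 1)).
have [U /fin_all_exists[W /fin_all_exists[D]]] :=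
  fin_all_exists (fun n : 'I_#|T|.+1 => diag n).
move/all_and2=> [WU LU] {diag}.
(* Matrices are extended by zero to pairs of sets outside [A n], so eigenvectors vanish in the other
   degrees. *)
pose ext n (M : 'M[R]_#|A n|) G F :=
  if [pick p | (enum_val p.1 == G) && (enum_val p.2 == F)] is Some p
  then M p.1 p.2 else 0.
have extE n M a b : ext n M (enum_val a) (enum_val b) = M a b.
  rewrite /ext; case: pickP => [[a' b'] /=|/(_ (a, b))]; last by rewrite !eqxx.
  by case/andP=> /eqP/enum_val_inj-> /eqP/enum_val_inj->.
have AE n F : (F \in A n) = (F \in X) && (#|F| == n).
  by rewrite inE (inj_eq (addIr _)).
have ext0 (n : 'I_#|T|.+1) M G F : (#|G| != n) || (#|F| != n) -> ext n M G F = 0.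
  rewrite /ext; case: pickP => // -[a b] /= /andP[/eqP<- /eqP<-].
  have := enum_valP a; have := enum_valP b; rewrite !AE.
  by case/andP=> _ -> /andP[_ ->].
pose rk F : 'I_#|T|.+1 := inord #|F|.
have rkE F : rk F = #|F| :> nat by rewrite inordK // ltnS max_card.
have enumE F (n : 'I_#|T|.+1) : F \in X -> #|F| = n ->
    exists a : 'I_#|A n|, F = enum_val a.
  move=> FX cF; have FA : F \in A n by rewrite AE FX cF /=.
  by exists (enum_rank_in FA F); rewrite enum_rankK_in.
(* Within its degree, [F] labels the eigenvector at its own position in the enumeration: a column of
   [U], hence the swapped arguments, and a row of [W]. *)
exists (fun F => ext _ (diag_mx (D (rk F))) F F).
exists (fun F H => ext _ (U (rk F)) H F).
exists (fun F H => ext _ (W (rk F)) F H); split.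
- move=> F H FX HX; have := rkE F; move: (rk F) => n /esym cF.
  have [cH|neH] := eqVneq #|H| n; last first.
    rewrite (ext0 _ (U n)) ?neH // mulr0; apply: lap_eq0 => G _ cG.
    by rewrite ext0 // cG neH.
  have [f ->] := enumE _ _ FX cF; have [h ->] := enumE _ _ HX cH.
  rewrite !extE -(@laplacian_lap _ (n%:Z - 1)) => [|G _].
    under eq_bigr => b _ do rewrite extE.
    have /matrixP/(_ h f) := LU n; rewrite mul_mx_diag !mxE => ->.
    by rewrite eqxx mulrC.
  by rewrite (inj_eq (addIr _)) => neG; rewrite ext0 // neG.
- move=> F G FX GX; have [eFG|neFG] := eqVneq #|F| #|G|; last first.
    have /negPf-> : F != G by apply: contraNneq neFG => ->.
    apply: big1 => H _; have [eHF|neHF] := eqVneq #|H| #|F|.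
      by rewrite (ext0 _ (U _)) ?mulr0 // eHF rkE neFG.
    by rewrite (ext0 _ (W _)) ?mul0r // !rkE neHF orbT.
  have <- : rk F = rk G by apply: val_inj; rewrite /= !rkE.
  have := rkE F; move: (rk F) => n /esym cF.
  have [f ->] := enumE _ _ FX cF.
  have [g ->] := enumE _ _ GX (etrans (esym eFG) cF).
  rewrite -(@sum_faces_dim _ (n%:Z - 1)) => [|H _]; last first.
    by rewrite (inj_eq (addIr _)) => neH; rewrite ext0 ?neH ?orbT // mul0r.
  under eq_bigr => b _ do rewrite !extE.
  have /matrixP/(_ f g) := WU n; rewrite !mxE => ->.
  by rewrite (inj_eq enum_val_inj).
by move=> F H _ _ ne; rewrite ext0 // rkE eq_sym ne.
Qed.
End Eigenbasis.

(** * Shuffle signs and the boundary of a join *)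

Section Shuffle.
Variables (R : rcfType) (T : finType).
Implicit Types (F G : {set T}) (v : T).

Lemma big_disjointU (M : nmodType) (F G : {set T}) (f : T -> M) :
  [disjoint F & G] ->
  \sum_(v in F :|: G) f v = \sum_(v in F) f v + \sum_(v in G) f v.
Proof.
move=> dFG; rewrite -bigU //.
by apply: eq_bigl => v; rewrite in_setU.
Qed.

Definition below F v : nat := \sum_(u in F) (enum_rank u < enum_rank v)%N.

Lemma vertex_signE F v : vertex_sign R F v = (-1) ^+ below F v.
Proof.
rewrite /vertex_sign /below -sum1_card big_mkcond [in RHS]big_mkcond.
congr (_ ^+ _); apply: eq_bigr => u _; rewrite inE.
by case: (u \in F); case: (_ < _)%N.
Qed.

Lemma below_setU F G v :
  [disjoint F & G] -> below (F :|: G) v = (below F v + below G v)%N.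
Proof. exact: big_disjointU. Qed.

Definition inversions F G : nat := \sum_(a in F) below G a.

(* The sign of the permutation that sorts the concatenation of F and G. *)
Definition shuffle_sign F G : R := (-1) ^+ inversions F G.

Lemma shuffle_sign_sqr F G : shuffle_sign F G * shuffle_sign F G = 1.
Proof. by rewrite -expr2 sqrr_sign. Qed.

Lemma shuffle_signK F G (s x y : R) :
  s * shuffle_sign F G * x * (shuffle_sign F G * y) = s * (x * y).
Proof.
by rewrite mulrACA -(mulrA s) shuffle_sign_sqr mulr1 mulrA.
Qed.

Lemma inversions_setD1l F G v :
  v \in F -> inversions F G = (below G v + inversions (F :\ v) G)%N.
Proof. exact: big_setD1. Qed.

(** Each element of [F] either precedes [v], and is counted by [below F v], or follows it, and forms
    an inversion with it. *)
Lemma inversions_setD1r F G v : v \notin F -> v \in G ->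
  (inversions F G + below F v = #|F| + inversions F (G :\ v))%N.
Proof.
move=> vF vG; rewrite -sum1_card /inversions /below -!big_split /=.
apply: eq_bigr => a aF; rewrite (big_setD1 v) //= addnAC; congr (_ + _)%N.
have /negPf nav : enum_rank a != enum_rank v.
  by rewrite (inj_eq enum_rank_inj); apply: contraNneq vF => <-.
by rewrite -val_eqE /= in nav; case: ltngtP nav.
Qed.

Variables V W : {set T}.
Hypothesis dVW : [disjoint V & W].

Lemma setUI_disjoint F G : F \subset V -> G \subset W ->
  ((F :|: G) :&: V = F) * ((F :|: G) :&: W = G).
Proof.
move=> sF sG; rewrite !setIUl (setIidPl sF) (setIidPl sG).
have -> : G :&: V = set0.
  by apply/eqP; rewrite setI_eq0 disjoint_sym; apply: disjointWr sG dVW.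
have -> : F :&: W = set0.
  by apply/eqP; rewrite setI_eq0; apply: disjointWl sF dVW.
by rewrite set0U setU0.
Qed.

Lemma eq_setU_disjoint F F' G G' : F \subset V -> F' \subset V ->
  G \subset W -> G' \subset W ->
  (F :|: G == F' :|: G') = (F == F') && (G == G').
Proof.
move=> sF sF' sG sG'; apply/eqP/andP => [E|[/eqP-> /eqP->] //].
have [eF eG] := setUI_disjoint sF sG; have [eF' eG'] := setUI_disjoint sF' sG'.
by split; apply/eqP; [rewrite -[LHS]eF E | rewrite -[LHS]eG E].
Qed.

(* The Leibniz rule for the boundary of a join, whose orientation differs from
   the product orientation by shuffle signs. *)
Lemma incidence_join F1 F2 G1 G2 : F1 \subset V -> G1 \subset V ->
  F2 \subset W -> G2 \subset W ->
  incidence R (F1 :|: F2) (G1 :|: G2) =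
  shuffle_sign F1 F2 * shuffle_sign G1 G2 *
    (incidence R F1 G1 * (F2 == G2)%:R +
     (-1) ^+ #|F1| * (F1 == G1)%:R * incidence R F2 G2).
Proof.
move=> sF1 sG1 sF2 sG2.
have dG : [disjoint G1 & G2] by apply: disjointW sG1 sG2 dVW.
have incE F G : incidence R F G =
    \sum_(v in G) (G :\ v == F)%:R * vertex_sign R G v.
  rewrite /incidence big_mkcondr; apply: eq_bigr => v _.
  by case: ifP => _; rewrite ?mul1r ?mul0r.
rewrite -[LHS]mulr1 -[in LHS](shuffle_sign_sqr G1 G2) mulrA.
rewrite [RHS]mulrAC; congr (_ * _).
(* Deleting a vertex of [G1] gives the first term of the Leibniz rule, deleting one of [G2] the
   second. *)
rewrite [in LHS]incE big_disjointU // mulrDl mulrDr; congr (_ + _).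
  rewrite incE !mulr_suml mulr_sumr; apply: eq_bigr => v vG1.
  have vG2 : v \notin G2 by rewrite (disjointFr dG).
  have -> : (G1 :|: G2) :\ v = (G1 :\ v) :|: G2.
    by rewrite setDUl; congr (_ :|: _); apply/setDidPl;
      rewrite disjoint_sym disjoints1.
  rewrite eq_setU_disjoint // ?(subset_trans (subD1set _ _)) //.
  have [<-|_] := eqVneq (G1 :\ v) F1; last by rewrite !mul0r mulr0.
  have [->|_] := eqVneq F2 G2; last by rewrite !(mul0r, mulr0).
  (* [below G2 v] occurs both in the vertex sign and in the inversions, so the exponents agree only
     modulo 2. *)
  rewrite !mul1r mulr1 !vertex_signE below_setU // /shuffle_sign.
  rewrite (inversions_setD1l G2 vG1) -!exprD.
  rewrite -[LHS]signr_odd -[RHS]signr_odd !oddD.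
  by move: (odd (below G1 v)) (odd (below G2 v)) (odd (inversions _ _)) =>
    [] [] [].
rewrite incE mulr_suml !mulr_sumr; apply: eq_bigr => v vG2.
have vG1 : v \notin G1 by rewrite (disjointFl dG).
have -> : (G1 :|: G2) :\ v = G1 :|: (G2 :\ v).
  by rewrite setDUl; congr (_ :|: _); apply/setDidPl;
      rewrite disjoint_sym disjoints1.
rewrite eq_setU_disjoint // ?(subset_trans (subD1set _ _)) //.
have [<-|_] := eqVneq G1 F1; last by rewrite !(mul0r, mulr0).
have [<-|_] := eqVneq (G2 :\ v) F2; last by rewrite !(mul0r, mulr0).
(* Here the exponents are equal; moving [v] past all of [G1] produces the sign of exponent
   [#|G1|]. *)
rewrite !mul1r mulr1 !vertex_signE below_setU // /shuffle_sign -!exprD.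
by rewrite addnAC (addnC (below _ _)) inversions_setD1r // addnA (addnC #|G1|).
Qed.

(** * Tensor products of chains on a join *)

Variables X Y : {set {set T}}.
Hypothesis sX : {in X, forall F, F \subset V}.
Hypothesis sY : {in Y, forall G, G \subset W}.
Let Z := join_faces X Y.

Lemma mem_joinU F G : F \in X -> G \in Y -> F :|: G \in Z.
Proof. by move=> FX GY; apply/imset2P; exists F G. Qed.

Lemma big_join (M : nmodType) (f : {set T} -> M) :
  \sum_(H in Z) f H = \sum_(F in X) \sum_(G in Y) f (F :|: G).
Proof.
rewrite /Z /join_faces curry_imset2X big_imset /= => [|[F G] [F' G']].
  by rewrite pair_big /=; apply: eq_big => [[F G]|[F G] _] //; rewrite !inE.
rewrite !inE /= => /andP[FX GY] /andP[FX' GY'] /eqP.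
by rewrite eq_setU_disjoint ?sX ?sY // => /andP[/eqP-> /eqP->].
Qed.

(** Traces on [V] and [W] recover the two factors of a face; the sign converts the product
    orientation into that of the enumeration. *)
Definition tensor (a c : {set T} -> R) H : R :=
  shuffle_sign (H :&: V) (H :&: W) * (a (H :&: V) * c (H :&: W)).

Lemma tensorU a c F G : F \in X -> G \in Y ->
  tensor a c (F :|: G) = shuffle_sign F G * (a F * c G).
Proof. by move=> /sX FX /sY GY; rewrite /tensor !(setUI_disjoint FX GY). Qed.

(** The grading involution, which carries the Koszul sign of the Leibniz rule. *)
Definition twist (a : {set T} -> R) F := (-1) ^+ #|F| * a F.

Lemma bd_twist S a F : bd S (twist a) F = - twist (bd S a) F.
Proof.
rewrite /bd /twist mulr_sumr -sumrN; apply: eq_bigr => G _.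
have [->|/incidence_card->] := eqVneq (incidence R F G) 0.
  by rewrite !mul0r mulr0 oppr0.
by rewrite exprS; ring.
Qed.

Lemma cobd_twist S a F : cobd S (twist a) F = - twist (cobd S a) F.
Proof.
rewrite /cobd /twist mulr_sumr -sumrN; apply: eq_bigr => G _.
have [->|/incidence_card->] := eqVneq (incidence R G F) 0.
  by rewrite !mul0r mulr0 oppr0.
by rewrite exprS; ring.
Qed.

Lemma twistK a F : twist (twist a) F = a F.
Proof. by rewrite /twist signrMK. Qed.

Lemma sum_delta (S : {set {set T}}) (c : {set T} -> R) G : G \in S ->
  \sum_(H in S) (G == H)%:R * c H = c G.
Proof.
move=> GS; rewrite (bigD1 G) //= eqxx mul1r big1 ?addr0 // => H /andP[_ /negPf].
by rewrite eq_sym => ->; rewrite mul0r.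
Qed.

Lemma bd_tensor a c F G : F \in X -> G \in Y ->
  bd Z (tensor a c) (F :|: G) =
  tensor (bd X a) c (F :|: G) + tensor (twist a) (bd Y c) (F :|: G).
Proof.
move=> FX GY; rewrite !tensorU // -mulrDr /bd big_join.
transitivity (shuffle_sign F G * \sum_(F' in X)
  (incidence R F F' * a F' * (\sum_(G' in Y) (G == G')%:R * c G') +
   (F == F')%:R * (twist a F' * \sum_(G' in Y) incidence R G G' * c G'))).
  rewrite mulr_sumr; apply: eq_bigr => F' FX'.
  rewrite !mulr_sumr -big_split /= mulr_sumr; apply: eq_bigr => G' GY'.
  rewrite tensorU // incidence_join ?sX ?sY // shuffle_signK /twist.
  (* The Leibniz sign is that of [F], whereas [twist] uses [F']; they agree where the delta is
     nonzero. *)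
  by congr (_ * _); have [->|_] := eqVneq F F'; rewrite /=; ring.
by rewrite big_split /= sum_delta // -mulr_suml sum_delta.
Qed.

Lemma cobd_tensor a c F G : F \in X -> G \in Y ->
  cobd Z (tensor a c) (F :|: G) =
  tensor (cobd X a) c (F :|: G) + tensor (twist a) (cobd Y c) (F :|: G).
Proof.
move=> FX GY; rewrite !tensorU // -mulrDr /cobd big_join.
transitivity (shuffle_sign F G * \sum_(F' in X)
  (incidence R F' F * a F' * (\sum_(G' in Y) (G == G')%:R * c G') +
   (F == F')%:R * (twist a F' * \sum_(G' in Y) incidence R G' G * c G'))).
  rewrite mulr_sumr; apply: eq_bigr => F' FX'.
  rewrite !mulr_sumr -big_split /= mulr_sumr; apply: eq_bigr => G' GY'.
  rewrite tensorU // incidence_join ?sX ?sY // (eq_sym F') (eq_sym G').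
  rewrite (mulrC (shuffle_sign F' G')) shuffle_signK /twist.
  by ring.
by rewrite big_split /= sum_delta // -mulr_suml sum_delta.
Qed.

Lemma lap_tensor a c F G : F \in X -> G \in Y ->
  lap Z (tensor a c) (F :|: G) =
  shuffle_sign F G * (lap X a F * c G + a F * lap Y c G).
Proof.
move=> FX GY.
(* The tensor decompositions hold only on [Z], which suffices because all sums range over [Z]. *)
have lap_split (f g h k : {set T} -> R) :
  {in Z, bd Z (tensor a c) =1 fun H => f H + g H} ->
  {in Z, cobd Z (tensor a c) =1 fun H => h H + k H} ->
  {in Z, lap Z (tensor a c) =1
     fun H => bd Z h H + bd Z k H + (cobd Z f H + cobd Z g H)}.
  move=> eb ec H HZ; rewrite /lap; congr (_ + _).
    rewrite /bd -big_split; apply: eq_bigr => K KZ; rewrite ec //=.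
    by rewrite mulrDr.
  rewrite /cobd -big_split; apply: eq_bigr => K KZ; rewrite eb //=.
  by rewrite mulrDr.
rewrite (lap_split (tensor (bd X a) c) (tensor (twist a) (bd Y c))
  (tensor (cobd X a) c) (tensor (twist a) (cobd Y c))) ?mem_joinU //=; first last.
- by move=> _ /imset2P[F' G' FX' GY' ->]; rewrite cobd_tensor.
- by move=> _ /imset2P[F' G' FX' GY' ->]; rewrite bd_tensor.
(* Each cross term contains [twist] either outside or inside an operator on [X]; [bd_twist] and
   [cobd_twist] make them cancel in pairs. *)
rewrite !bd_tensor // !cobd_tensor // !tensorU // !bd_twist !cobd_twist.
by rewrite !twistK /lap /twist; ring.
Qed.

Lemma eigenbasis_join dX dY uX uY wX wY :
  eigenbasis X dX uX wX -> eigenbasis Y dY uY wY ->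
  eigenbasis Z (fun H => dX (H :&: V) + dY (H :&: W))
    (fun H => tensor (uX (H :&: V)) (uY (H :&: W)))
    (fun H => tensor (wX (H :&: V)) (wY (H :&: W))).
Proof.
move=> [lapX dualX cX] [lapY dualY cY].
have UI F G : F \in X -> G \in Y ->
    ((F :|: G) :&: V = F) * ((F :|: G) :&: W = G).
  by move=> FX GY; apply: setUI_disjoint; [apply: sX | apply: sY].
split=> _ _ /imset2P[F G FX GY ->] /imset2P[F' G' FX' GY' ->]; rewrite !UI //.
- by rewrite lap_tensor // tensorU // lapX // lapY //; ring.
- rewrite big_join eq_setU_disjoint ?sX ?sY // -mulnb natrM -dualX // -dualY //.
  rewrite mulr_suml; apply: eq_bigr => K KX.
  rewrite mulr_sumr; apply: eq_bigr => L LY; rewrite !tensorU //.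
  by rewrite mulrACA shuffle_sign_sqr mul1r mulrACA.
have card_join K L : K \in X -> L \in Y -> #|K :|: L| = (#|K| + #|L|)%N.
  move=> /sX KV /sY LW; rewrite cardsU (_ : K :&: L = set0) ?cards0 ?subn0 //.
  by apply/eqP; rewrite setI_eq0; apply: disjointW KV LW dVW.
rewrite tensorU // !card_join // => neFG.
(* Different total cardinalities force a difference in one factor, which then vanishes. *)
have [eF|neF] := eqVneq #|F| #|F'|; last by rewrite cX // mul0r mulr0.
by rewrite cY ?mulr0 //; apply: contraNneq neFG => ->; rewrite eF.
Qed.
End Shuffle.

(** * Spectrum polynomials as sums over faces labelled by eigenvalues *)

Lemma coef_eigenbasis (R : rcfType) (T : finType) (V : {set T})
    (P : simplicial_pair V) d (u w : {set T} -> {set T} -> R) n :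
  eigenbasis (pair_faces P) d u w ->
  (spectrum_poly R P)`_n =
  \sum_(F in pair_faces P) (#|F| == n)%:R * qpow (d F).
Proof.
move=> eP; rewrite coef_spectrum_poly (perm_big _ (spectrum_eigenbasis _ eP)).
rewrite big_map big_enum big_mkcond [RHS]big_mkcond; apply: eq_bigr => F _.
rewrite inE (inj_eq (addIr _)) -[_%:Z == _]/(#|F| == n).
by case: (F \in _); case: eqP; rewrite ?mul1r ?mul0r.
Qed.

Theorem corollary4p3 (R : realType) (T : finType) (V W : {set T})
    (P : simplicial_pair V) (Q : simplicial_pair W)
    (dVW : [disjoint V & W]) :
  spectrum_poly R (join_pair P Q) = spectrum_poly R P * spectrum_poly R Q.
Proof.
have [dX [uX [wX eX]]] := exists_eigenbasis R (pair_faces P).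
have [dY [uY [wY eY]]] := exists_eigenbasis R (pair_faces Q).
have sP : {in pair_faces P, forall F : {set T}, F \subset V}.
  by move=> F /setDP[/complex_sub].
have sQ : {in pair_faces Q, forall F : {set T}, F \subset W}.
  by move=> F /setDP[/complex_sub].
have := eigenbasis_join dVW sP sQ eX eY.
rewrite -join_pair_faces // => eZ; apply/polyP=> n.
rewrite coefM (coef_eigenbasis _ eZ) join_pair_faces // (big_join dVW) //.
under [RHS]eq_bigr => j _ do
  rewrite (coef_eigenbasis _ eX) (coef_eigenbasis _ eY) mulr_suml.
rewrite [RHS]exchange_big /=; apply: eq_bigr => F FX.
under [RHS]eq_bigr => j _ do rewrite mulr_sumr.
rewrite [RHS]exchange_big /=; apply: eq_bigr => G GY.
have [sF sG] := (sP F FX, sQ G GY); rewrite !(setUI_disjoint dVW sF sG).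
rewrite qpowD ?(eigenbasis_ge0 eX) ?(eigenbasis_ge0 eY) //.
under eq_bigr => j _ do rewrite mulrACA.
rewrite -mulr_suml; congr (_ * _).
rewrite cardsU (_ : F :&: G = set0) ?cards0 ?subn0; last first.
  by apply/eqP; rewrite setI_eq0; apply: disjointW sF sG dVW.
(* Only [j = #|F|] can contribute to the convolution, and it is in range only if [#|F| <= n].
   Otherwise both sides vanish. *)
have [ltnF|leFn] := ltnP n #|F|.
  rewrite gtn_eqF ?ltn_addr // big1 // => j _.
  by rewrite gtn_eqF ?mul0r // (leq_ltn_trans _ ltnF) // -ltnS.
rewrite (bigD1 (Ordinal (leFn : #|F| < n.+1)%N)) //= eqxx mul1r big1 => [|j].
  by rewrite addr0 -(eqn_add2l #|F| #|G|) subnKC.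
by rewrite -val_eqE eq_sym /= => /negPf->; rewrite mul0r.
Qed.
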